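(* Let $q=p^{\alpha}$, where $p$ is a prime and $\alpha$ a positive integer, and list the elements of $GF(q)$ as $a_0=0,a_1,\dots,a_{q-1}$. Let $t,s$ be integers with $1\leq t,s<\frac{q-1}{2}$, and let $A=[a_{ij}]$ and $B=[b_{ij}]$ be the $q\times q$ matrices over $GF(q)$ with entries $a_{ij}=a_j^{t}-a_i^{t}$ and $b_{ij}=a_j^{s}-a_i^{s}$ for $0\le i,j\le q-1$. Then $AB=\mathbf{0}$ over $GF(q)$. *)

(* Defs.v *)
From HB Require Import structures.
From mathcomp Require Export all_boot all_order all_algebra.
Set Implicit Arguments.
Unset Strict Implicit.
Unset Printing Implicit Defensive.

(* Main.v *)
Require Import Defs.
From mathcomp Require Import all_boot all_order all_algebra.
Import GRing.Theory.
Local Open Scope ring_scope.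

(** Expanding an entry of [A *m B] gives a combination of the power sums of
    exponents [0], [s], [t] and [t + s] over the whole field.  All of these
    exponents are less than [q - 1], and such power sums vanish: for
    [0 < n < q - 1] some nonzero [b] satisfies [b ^+ n != 1], and
    the substitution [x := b * x] multiplies the sum by [b ^+ n]. *)

Lemma natr_card_finField (F : finFieldType) : #|F|%:R = 0 :> F.
Proof.
(* The substitution [x := x + 1] adds [#|F|%:R] to the sum of all elements. *)
have H : \sum_(x : F) x = \sum_(x : F) x + #|F|%:R.
  rewrite {1}(reindex_inj (addIr 1)) big_split /=.
  by rewrite sumr_const.
by apply: (addrI (\sum_(x : F) x)); rewrite addr0 -H.
Qed.

(** Otherwise all [#|F|.-1] nonzero elements would be roots of ['X^n - 1], a nonzero polynomial of
    degree [n < #|F|.-1]. *)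
Lemma finField_expr_neq1 (F : finFieldType) (n : nat) :
  (0 < n)%N -> (n < #|F|.-1)%N -> exists2 b : F, b != 0 & b ^+ n != 1.
Proof.
move=> n_gt0 n_lt.
have [/existsP[b /andP[b0 bn]]|/existsPn noex] :=
  boolP [exists b : F, (b != 0) && (b ^+ n != 1)]; first by exists b.
have Xn1_neq0 : 'X^n - 1 != 0 :> {poly F}.
  by rewrite -size_poly_eq0 size_XnsubC.
have all_roots : all (root ('X^n - 1 : {poly F})) (enum (predC1 (0 : F))).
  apply/allP=> b; rewrite mem_enum inE => b0.
  have := noex b; rewrite b0 /= negbK => /eqP bn.
  by rewrite /root !hornerE bn subrr.
have := max_poly_roots Xn1_neq0 all_roots (enum_uniq _).
by rewrite -cardE cardC1 size_XnsubC // ltnS leqNgt n_lt.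
Qed.

Lemma sum_expr_finField (F : finFieldType) (n : nat) :
  (n < #|F|.-1)%N -> \sum_(x : F) x ^+ n = 0.
Proof.
(* Since [0 ^+ 0 = 1], the sum for [n = 0] is [#|F|%:R]. *)
case: (posnP n) => [-> _|n_gt0 n_lt].
  by under eq_bigr do rewrite expr0; rewrite sumr_const natr_card_finField.
have [b b0 bn] := finField_expr_neq1 F n n_gt0 n_lt.
have H : \sum_(x : F) x ^+ n = b ^+ n * \sum_(x : F) x ^+ n.
  rewrite {1}(reindex_inj (mulfI b0)) /= mulr_sumr.
  by apply: eq_bigr => x _; rewrite exprMn.
apply/eqP; have /eqP := H.
rewrite -subr_eq0 -{1}[\sum_(x : F) _]mul1r -mulrBl mulf_eq0 subr_eq0.
by rewrite eq_sym (negPf bn).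
Qed.

Theorem theorem3 (p alpha q : nat) (F : finFieldType) (a : 'I_q -> F)
    (t s : nat)
    (hp : prime p) (halpha : (0 < alpha)%N) (hq : q = (p ^ alpha)%N)
    (hF : #|F| = q)
    (ha : bijective a) (ha0 : forall i : 'I_q, i = 0%N :> nat -> a i = 0)
    (ht1 : (1 <= t)%N) (ht2 : (2 * t < q - 1)%N)
    (hs1 : (1 <= s)%N) (hs2 : (2 * s < q - 1)%N) :
  let A : 'M[F]_q := \matrix_(i < q, j < q) (a j ^+ t - a i ^+ t) in
  let B : 'M[F]_q := \matrix_(i < q, j < q) (a j ^+ s - a i ^+ s) in
  A *m B = 0.
Proof.
have ts_lt : (t + s < q - 1)%N.
  (* After doubling, this is the sum of [ht2] and [hs2]. *)
  rewrite -(ltn_pmul2l (isT : (0 < 2)%N)) mulnDr [ltnRHS]mul2n -addnn -addSn.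
  exact: leq_add ht2 (ltnW hs2).
(* The bound [t + s] covers all four exponents; the bijection [a] turns sums over indices into sums
   over [F]. *)
have sum0 n : (n <= t + s)%N -> \sum_(k < q) a k ^+ n = 0.
  move=> n_le; transitivity (\sum_(x : F) x ^+ n).
    by rewrite [RHS](reindex a) //; exact: onW_bij.
  by apply: sum_expr_finField; rewrite hF -subn1 (leq_ltn_trans n_le).
move=> A B; apply/matrixP=> i j; rewrite !mxE.
(* The term free of [k] is written with the power sum of exponent [0], so that [sum0] applies to it
   as well. *)
have -> : \sum_k A i k * B k j =
    (\sum_k a k ^+ t) * a j ^+ s - \sum_k a k ^+ (t + s)
    - (a i ^+ t * a j ^+ s * \sum_k a k ^+ 0 - a i ^+ t * \sum_k a k ^+ s).
  rewrite mulr_suml !mulr_sumr -!sumrB; apply: eq_bigr => k _.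
  by rewrite !mxE mulrBl !mulrBr exprD expr0 mulr1.
by rewrite !sum0 ?leq_addr ?leq_addl // mul0r !mulr0 !subr0.
Qed.
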